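(* Let $\mathcal{R}$ be a tolerance relation on $X=\{1,\dots,n\}$ whose graph $G(\mathcal{R})$ is chordal, and let $\mathcal{C}$ be the set of maximal cliques of $G(\mathcal{R})$. Then the map $$\Phi: E(\mathcal{R})^d\to \bigoplus_{C\in\mathcal{C}} M_{|C|}(\mathbb{C}),\qquad (x_{ij})\mapsto \big((x_{ij})_{i,j\in C}\big)_{C\in\mathcal{C}}$$ is a complete order embedding, i.e. for every $m$ the map $\Phi_m$ (entrywise application of $\Phi$) is injective and an element $M\in M_m(E(\mathcal{R})^d)$ lies in $M_m(E(\mathcal{R})^d)_+$ if and only if $\Phi_m(M)$ is positive in the $C^*$-algebra $M_m\big(\bigoplus_{C\in\mathcal{C}}M_{|C|}(\mathbb{C})\big)$.
   Context: A tolerance relation on $X=\{1,\dots,n\}$ is a reflexive symmetric relation $\mathcal{R}\subseteq X\times X$; its graph $G(\mathcal{R})$ has vertex set $X$ and an edge between distinct $i,j$ iff $(i,j)\in\mathcal{R}$. A graph is chordal if every cycle of length at least 4 has a chord (an edge joining two vertices not adjacent in the cycle). The operator system $E(\mathcal{R})=\{(x_{ij})\in M_n(\mathbb{C})\mid x_{ij}=0 \text{ if }(i,j)\notin\mathcal{R}\}$ carries the matrix order inherited from $M_n(\mathbb{C})$. Its dual operator system $E(\mathcal{R})^d$ is identified (via the Hilbert–Schmidt pairing) with the $*$-vector space $E(\mathcal{R})$ (usual conjugate transpose) equipped with the matrix order $$M_m(E(\mathcal{R})^d)_+=\{M\in M_m(E(\mathcal{R}))\mid \exists N\in M_m(E(\mathcal{R})^\perp),\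 M+N\in M_{mn}(\mathbb{C})_+\},$$ where $E(\mathcal{R})^\perp=\{(y_{ij})\in M_n(\mathbb{C})\mid y_{ij}=0\text{ for }(i,j)\in\mathcal{R}\}$ is the Hilbert–Schmidt orthogonal complement and $M_m(M_n(\mathbb{C}))\cong M_{mn}(\mathbb{C})$ canonically; the identity matrix serves as matrix order unit. In the direct sum, matrices in the $C$-component are indexed by $C$. *)

(* Defs.v *)
From HB Require Import structures.
From mathcomp Require Import all_boot all_order all_algebra all_reals.
From mathcomp Require Import complex.
Set Implicit Arguments. Unset Strict Implicit. Unset Printing Implicit Defensive.
Import Order.TTheory GRing.Theory Num.Theory.
Local Open Scope ring_scope.

Definition tolerance (n : nat) (Rel : rel 'I_n) : Prop :=
  (forall i, Rel i i) /\ (forall i j, Rel i j = Rel j i).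

Definition gadj (n : nat) (Rel : rel 'I_n) : rel 'I_n :=
  fun i j => (i != j) && Rel i j.

Definition chordal (n : nat) (Rel : rel 'I_n) : Prop :=
  forall s : seq 'I_n, (4 <= size s)%N -> uniq s -> cycle (gadj Rel) s ->
    exists x y, [/\ x \in s, y \in s, gadj Rel x y, next s x != y & prev s x != y].

Definition clique (n : nat) (Rel : rel 'I_n) (C : {set 'I_n}) : Prop :=
  forall i j, i \in C -> j \in C -> i != j -> Rel i j.

Definition max_clique (n : nat) (Rel : rel 'I_n) (C : {set 'I_n}) : Prop :=
  clique Rel C /\ (forall D : {set 'I_n}, clique Rel D -> C \subset D -> D = C).

(* E(R) and its Hilbert-Schmidt orthogonal complement *)
Definition inE_R (C : Type) (zero : C) (n : nat) (Rel : rel 'I_n) (x : 'M[C]_n) : Prop :=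
  forall i j, ~~ Rel i j -> x i j = zero.
Definition inE_perp (C : Type) (zero : C) (n : nat) (Rel : rel 'I_n) (y : 'M[C]_n) : Prop :=
  forall i j, Rel i j -> y i j = zero.

Definition adjmx (C : numClosedFieldType) (p q : nat) (A : 'M[C]_(p, q)) : 'M[C]_(q, p) :=
  map_mx Num.conj A^T.

Definition psd (C : numClosedFieldType) (k : nat) (A : 'M[C]_k) : Prop :=
  adjmx A = A /\ forall v : 'cV[C]_k, 0 <= (adjmx v *m A *m v) 0 0.

(* canonical identification M_m(M_n(C)) = M_{mn}(C): block matrix *)
Definition blockmx (C : numClosedFieldType) (m n : nat) (M : 'M['M[C]_n]_m)
  : 'M[C]_(\sum_(k < m) n) :=
  \mxblock_(k < m, l < m) M k l.

Definition restr (C : numClosedFieldType) (n : nat) (D : {set 'I_n}) (x : 'M[C]_n)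
  : 'M[C]_#|D| :=
  \matrix_(i, j) x (enum_val i) (enum_val j).

(* matrix order of the dual operator system E(R)^d at level m *)
Definition dual_pos (C : numClosedFieldType) (n : nat) (Rel : rel 'I_n) (m : nat)
  (M : 'M['M[C]_n]_m) : Prop :=
  exists N : 'M['M[C]_n]_m, (forall k l, inE_perp 0 Rel (N k l)) /\ psd (blockmx (M + N)).

(* Phi_m(M) is positive in M_m(direct sum over maximal cliques) iff every
   component (Phi_C)_m(M) is positive in M_m(M_|C|(C)) *)
Definition phi_pos (C : numClosedFieldType) (n : nat) (Rel : rel 'I_n) (m : nat)
  (M : 'M['M[C]_n]_m) : Prop :=
  forall D : {set 'I_n}, max_clique Rel D ->
    psd (blockmx (\matrix_(k, l) restr D (M k l))).

(* Main.v *)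
Require Import Defs.
From HB Require Import structures.
From mathcomp Require Import all_boot all_order all_algebra all_reals.
From mathcomp Require Import complex ring.
Import Order.TTheory GRing.Theory Num.Theory.
Local Open Scope ring_scope.

(** The nontrivial implication is the positive completion theorem for chordal
patterns, for entries that are m x m blocks. If the vertex set U is not a
clique, choose nonadjacent a, b in U, let A be the component of a outside the
closed neighbourhood of b, and let S be the set of neighbours of A outside A.
Every vertex of S is adjacent to b, so chordality forces S to be a clique. The
two sets A u S and U \ A are smaller, meet in S and have no edge between their
differences, so positive completions on the two of them agree on S and can be
glued. Gluing uses that the off-diagonal blocks of a positive matrix factor
through its diagonal blocks: if D is the common compression to S and the
off-diagonal blocks next to it are W D and D Z^*, then the missing corner can be
taken to be W D Z^*. When U is a clique, the
compression to a maximal clique containing U is positive by hypothesis. *)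

(** * Positive matrices: isotropic vectors, Schur complements, gluing *)

Section Psd.
Set Implicit Arguments.
Unset Strict Implicit.
Unset Printing Implicit Defensive.
Variable C : numClosedFieldType.

Lemma adjmxE p q (A : 'M[C]_(p, q)) i j : adjmx A i j = (A j i)^*.
Proof. by rewrite !mxE. Qed.

Lemma adjmxM p q r (A : 'M[C]_(p, q)) (B : 'M[C]_(q, r)) :
  adjmx (A *m B) = adjmx B *m adjmx A.
Proof. by rewrite /adjmx trmx_mul map_mxM. Qed.

Lemma adjmxD p q (A B : 'M[C]_(p, q)) : adjmx (A + B) = adjmx A + adjmx B.
Proof. by apply/matrixP => i j; rewrite !mxE rmorphD. Qed.

Lemma adjmxN p q (A : 'M[C]_(p, q)) : adjmx (- A) = - adjmx A.
Proof. by apply/matrixP => i j; rewrite !mxE rmorphN. Qed.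

Lemma adjmxB p q (A B : 'M[C]_(p, q)) : adjmx (A - B) = adjmx A - adjmx B.
Proof. by rewrite adjmxD adjmxN. Qed.

Lemma adjmxZ p q a (A : 'M[C]_(p, q)) : adjmx (a *: A) = a^* *: adjmx A.
Proof. by apply/matrixP => i j; rewrite !mxE rmorphM. Qed.

Lemma adjmxK p q (A : 'M[C]_(p, q)) : adjmx (adjmx A) = A.
Proof. by apply/matrixP => i j; rewrite !mxE conjCK. Qed.

Lemma adjmx1 p : adjmx (1%:M : 'M[C]_p) = 1%:M.
Proof. by rewrite /adjmx trmx1 map_mx1. Qed.

Lemma psdD p (A B : 'M[C]_p) : psd A -> psd B -> psd (A + B).
Proof.
move=> [hA pA] [hB pB]; split=> [|v]; first by rewrite adjmxD hA hB.
by rewrite mulmxDr mulmxDl mxE addr_ge0.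
Qed.

Lemma psd_congr p q (A : 'M[C]_p) (B : 'M[C]_(q, p)) :
  psd A -> psd (B *m A *m adjmx B).
Proof.
move=> [hA pA]; split=> [|v]; first by rewrite !adjmxM adjmxK hA mulmxA.
by have := pA (adjmx B *m v); rewrite adjmxM adjmxK !mulmxA.
Qed.

Lemma adjmx_self_eq0 p (w : 'cV[C]_p) : (adjmx w *m w) 0 0 = 0 -> w = 0.
Proof.
rewrite mxE => /eqP; rewrite psumr_eq0 => [/allP h|i _].
  apply/matrixP => i j; rewrite ord1 [RHS]mxE.
  have := h i (mem_index_enum _); rewrite adjmxE mulrC => /eqP e.
  by apply/eqP; rewrite -mul_conjC_eq0 e.
by rewrite adjmxE mulrC mul_conjC_ge0.
Qed.

(* Positivity of the form at [u - t A u] for small real [t > 0]. *)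
Lemma psd_isotropic p (A : 'M[C]_p) (u : 'cV[C]_p) :
  psd A -> (adjmx u *m A *m u) 0 0 = 0 -> A *m u = 0.
Proof.
move=> [hA pA] u0; apply: adjmx_self_eq0.
set w := A *m u; set c := (adjmx w *m w) 0 0.
set d := (adjmx w *m A *m w) 0 0.
have c0 : 0 <= c.
  by rewrite /c mxE sumr_ge0 // => i _; rewrite adjmxE mulrC mul_conjC_ge0.
have d0 : 0 <= d by exact: pA.
have d1 : 0 < d + 1 by rewrite ltr_wpDl.
(* The [+ 1] keeps the denominator positive. With [c = t * (d + 1)], the inequality 2tc <= t^2 d
   becomes t(td + 2t) <= 0, which forces t = 0. *)
pose t := c / (d + 1).
have t0 : 0 <= t by rewrite divr_ge0 // ltW.
have tJ : t^* = t by rewrite geC0_conj.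
have E : adjmx (u - t *: w) *m A *m (u - t *: w)
   = adjmx u *m A *m u - (t *: (adjmx w *m w)) *+ 2
     + (t ^+ 2) *: (adjmx w *m A *m w).
  rewrite adjmxB adjmxZ tJ !mulmxBl !mulmxBr -!scalemxAl -!scalemxAr.
  have -> : adjmx u *m A *m w = adjmx w *m w by rewrite /w adjmxM hA.
  have -> : adjmx w *m A *m u = adjmx w *m w by rewrite -mulmxA.
  rewrite scalerA -expr2 opprB mulr2n opprD !addrA.
  by rewrite addrAC.
have := pA (u - t *: w); rewrite {}E.
rewrite mxE [X in 0 <= X + _]mxE u0 add0r [X in 0 <= X + _]mxE.
rewrite [X in 0 <= - X + _]mxE [X in 0 <= - (X + _) + _]mxE.
rewrite [X in 0 <= - (_ + X) + _]mxE [X in 0 <= _ + X]mxE -/c -/d.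
rewrite -mulr2n addrC subr_ge0 => le2.
have ct : c = t * (d + 1) by rewrite /t divfK // gt_eqF.
have le3 : t * (t * d + t *+ 2) <= 0.
  have : (t * c) *+ 2 - t ^+ 2 * d <= 0 by rewrite subr_le0.
  by rewrite ct; congr (_ <= _); ring.
have tt : t = 0.
  apply/eqP; rewrite eq_le t0 andbT.
  have [-> //|tn0] := eqVneq t 0.
  have tp : 0 < t by rewrite lt_def tn0.
  move: le3; rewrite pmulr_rle0 // => le3.
  apply: le_trans le3; rewrite -subr_ge0.
  have -> : t * d + t *+ 2 - t = t * d + t by ring.
  by apply: addr_ge0 => //; apply: mulr_ge0.
by rewrite ct tt mul0r.
Qed.

Lemma psd_isotropic_mx p q (A : 'M[C]_p) (X : 'M[C]_(p, q)) :
  psd A -> adjmx X *m A *m X = 0 -> A *m X = 0.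
Proof.
move=> pA X0; apply/matrixP => i j.
have e0 : A *m col j X = 0.
  apply: psd_isotropic => //.
  rewrite colE adjmxM -!mulmxA (mulmxA A) (mulmxA (adjmx X)) (mulmxA (adjmx X)).
  by rewrite X0 mul0mx mulmx0 mxE.
move/matrixP/(_ i 0): e0; rewrite [RHS]mxE => e0.
by rewrite [RHS]mxE -[RHS]e0 !mxE; apply: eq_bigr => k _; rewrite !mxE.
Qed.

(** If P A P Q = 0, the columns of P Q are isotropic for A, so A P Q = 0. For Q the cokernel of P A
    P this is inclusion of row spaces, and [W] is its witness. *)
Lemma psd_range p (A P : 'M[C]_p) :
  psd A -> adjmx P = P -> exists W, A *m P = W *m (P *m A *m P).
Proof.
move=> pA hP; suff /submxP[W ->] : (A *m P <= P *m A *m P)%MS by exists W.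
set Q := cokermx (P *m A *m P); have PAPQ : P *m A *m P *m Q = 0.
  exact: mulmx_coker.
rewrite submxE -/Q -(mulmxA A); apply/eqP; apply: psd_isotropic_mx => //.
by rewrite adjmxM hP -!mulmxA; rewrite -!mulmxA in PAPQ; rewrite PAPQ mulmx0.
Qed.

(** The matrix is the congruence of A by 1 - W P. It is a Schur complement, with [W] standing for A
    P times a generalized inverse of P A P. *)
Lemma psd_schur p (A P W : 'M[C]_p) :
  psd A -> adjmx P = P -> A *m P = W *m (P *m A *m P) ->
  psd (A - W *m (P *m A *m P) *m adjmx W).
Proof.
move=> pA hP eW; have hA := pA.1.
have ePA : P *m A = P *m A *m P *m adjmx W.
  by rewrite -[LHS]adjmxK adjmxM hP hA eW !adjmxM hP hA mulmxA.
have := @psd_congr _ _ A (1%:M - W *m P) pA; congr psd.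
rewrite adjmxB adjmx1 adjmxM hP !mulmxBl !mulmxBr !mul1mx !mulmx1.
have -> : W *m P *m A = W *m (P *m A *m P) *m adjmx W.
  by rewrite -!mulmxA ePA !mulmxA.
have -> : A *m (P *m adjmx W) = W *m (P *m A *m P) *m adjmx W.
  by rewrite mulmxA eW.
have -> : W *m (P *m A *m P) *m adjmx W *m (P *m adjmx W)
   = W *m (P *m A *m P) *m adjmx W.
  by rewrite -!mulmxA; congr (W *m _); rewrite !mulmxA -ePA.
by rewrite subrr subr0.
Qed.

(* The completion is
   [(A - W D W^* ) + (B - Z D Z^* ) + (W + Z - 1) D (W + Z - 1)^*], where
   [A = P M P], [B = Q M Q], [K = P Q], [D = K M K], [A K = W D], [B K = Z D]. *)
Lemma psd_glue p (M P Q : 'M[C]_p) :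
  adjmx P = P -> adjmx Q = Q -> P *m P = P -> Q *m Q = Q -> P *m Q = Q *m P ->
  psd (P *m M *m P) -> psd (Q *m M *m Q) ->
  exists F, [/\ psd F, P *m F *m P = P *m M *m P & Q *m F *m Q = Q *m M *m Q].
Proof.
move=> hP hQ PP QQ PQ pA pB.
have [A eAM] : exists A, A = P *m M *m P by exists (P *m M *m P).
have [B eBM] : exists B, B = Q *m M *m Q by exists (Q *m M *m Q).
have [K PQK] : exists K, P *m Q = K by exists (P *m Q).
have [D eD] : exists D, D = K *m M *m K by exists (K *m M *m K).
have QPK : Q *m P = K by rewrite -PQ.
rewrite -eAM -eBM in pA pB *.
have hK : adjmx K = K by rewrite -PQK adjmxM hP hQ.
have PK : P *m K = K by rewrite -PQK mulmxA PP.
have KP : K *m P = K by rewrite -PQK -mulmxA -PQ mulmxA PP.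
have QK : Q *m K = K by rewrite -QPK mulmxA QQ.
have KQ : K *m Q = K by rewrite -PQK -mulmxA QQ.
have eA : K *m A *m K = D by rewrite eAM eD !mulmxA KP -!mulmxA PK !mulmxA.
have eB : K *m B *m K = D by rewrite eBM eD !mulmxA KQ -!mulmxA QK !mulmxA.
have [W eW] := psd_range pA hK; have [Z eZ] := psd_range pB hK.
have := psd_schur pB hK eZ; have := psd_schur pA hK eW.
move: eW eZ; rewrite eA eB => eW eZ pSA pSB.
have pD : psd D by rewrite -eA -{2}hK; exact: psd_congr.
have hD := pD.1.
have PD : P *m D = D by rewrite eD !mulmxA PK.
have QD : Q *m D = D by rewrite eD !mulmxA QK.
have PWD : P *m W *m D = W *m D by rewrite -mulmxA -eW mulmxA eAM !mulmxA PP.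
have QZD : Q *m Z *m D = Z *m D by rewrite -mulmxA -eZ mulmxA eBM !mulmxA QQ.
have PZD : P *m Z *m D = D.
  by rewrite -mulmxA -eZ eBM eD -(mulmxA _ Q K) QK !mulmxA PQK.
have QWD : Q *m W *m D = D.
  by rewrite -mulmxA -eW eAM eD -(mulmxA _ P K) PK !mulmxA QPK.
(* Since P Z D = D and Q W D = D, subtracting 1 gives P Y D = W D and Q Y D = Z D. *)
pose Y := W + Z - 1%:M.
have adjP (T X : 'M[C]_p) : adjmx T = T ->
    T *m (X *m D *m adjmx X) *m T = (T *m X *m D) *m adjmx (T *m X).
  by move=> hT; rewrite adjmxM hT !mulmxA.
have PYD : P *m Y *m D = W *m D.
  by rewrite /Y mulmxBr mulmxDr mulmx1 mulmxBl mulmxDl PWD PZD PD addrK.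
have QYD : Q *m Y *m D = Z *m D.
  rewrite /Y mulmxBr mulmxDr mulmx1 mulmxBl mulmxDl QWD QZD QD.
  by rewrite addrAC subrr add0r.
(* As D is self-adjoint, X D X^* depends on X only through X D, so the identities above suffice. *)
have sq (X X' : 'M[C]_p) : X *m D = X' *m D ->
    X *m D *m adjmx X = X' *m D *m adjmx X'.
  have dx T : D *m adjmx T = adjmx (T *m D) by rewrite adjmxM hD.
  by move=> e; rewrite e -!mulmxA !dx e.
clearbody Y.
exists ((A - W *m D *m adjmx W) + (B - Z *m D *m adjmx Z)
        + Y *m D *m adjmx Y).
split.
- by apply: psdD; [exact: psdD | exact: psd_congr].
(* Compressed by P, the B-summand becomes D - D = 0, and the Y-summand restores the W D W^* removed
   from A. The compression by Q is symmetric. *)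
- rewrite !(mulmxDr, mulmxDl) !(mulmxN, mulNmx) !adjP //.
  have -> : P *m A *m P = A by rewrite eAM !mulmxA PP -mulmxA PP.
  have -> : P *m B *m P = D.
    by rewrite eBM eD !mulmxA PQK -!mulmxA QPK.
  rewrite (sq _ W PYD) (sq _ W PWD) (sq (P *m Z) 1%:M) ?PZD ?mul1mx //.
  by rewrite adjmx1 mulmx1 subrr addr0 subrK.
- rewrite !(mulmxDr, mulmxDl) !(mulmxN, mulNmx) !adjP //.
  have -> : Q *m B *m Q = B by rewrite eBM !mulmxA QQ -mulmxA QQ.
  have -> : Q *m A *m Q = D.
    by rewrite eAM eD !mulmxA QPK -!mulmxA PQK.
  rewrite (sq _ Z QYD) (sq _ Z QZD) (sq (Q *m W) 1%:M) ?QWD ?mul1mx //.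
  by rewrite adjmx1 mulmx1 subrr add0r subrK.
Qed.
End Psd.

(** * Shortening a path to a chordless one *)

Section InducedPath.
Set Implicit Arguments.
Unset Strict Implicit.
Unset Printing Implicit Defensive.
Variables (T : eqType) (e : rel T).

(** Chordless path. Edges are tested only towards later vertices, which covers every chord once [e]
    is symmetric. *)
Fixpoint induced_path (x : T) (p : seq T) : bool :=
  if p is z :: q then
    [&& e x z, ~~ has (e x) q, x \notin p & induced_path z q]
  else true.

Lemma induced_path_path x p : induced_path x p -> path e x p.
Proof. by elim: p x => //= z q IH x /and4P[-> _ _ /IH]. Qed.

Lemma induced_path_uniq x p : induced_path x p -> uniq (x :: p).
Proof. by elim: p x => //= z q IH x /and4P[_ _ -> /IH]. Qed.

Lemma induced_path_suffix x z q : induced_path z q -> x \in z :: q ->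
  exists p, [/\ induced_path x p, last x p = last z q & {subset p <= z :: q}].
Proof.
elim: q z => [|w q IH] z /=; first by rewrite inE => _ /eqP ->; exists [::].
case/and4P=> ezw nq zn iq; rewrite inE => /orP[/eqP ->|xq].
  exists (w :: q); split=> //=; first by rewrite ezw nq zn iq.
  by move=> y yq; rewrite inE yq orbT.
have [p [ip lp sp]] := IH w iq xq; exists p; split=> // y /sp yq.
by rewrite inE yq orbT.
Qed.

(** Attach [x] to its last neighbour on the path and drop the vertices before that neighbour. *)
Lemma induced_path_cons x z q : induced_path z q -> has (e x) (z :: q) ->
    x \notin z :: q ->
  exists p, [/\ induced_path x p, last x p = last z q & {subset p <= z :: q}].
Proof.
elim: q z => [|w q IH] z ip ex xn.
  by move: ex; rewrite has_seq1 => ex; exists [:: z]; split=> //=; rewrite ex xn.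
have [h|nh] := boolP (has (e x) (w :: q)); last first.
  exists (z :: w :: q); split=> //; 
  move: ex; rewrite -cat1s has_cat (negPf nh) orbF has_seq1 => exz.
  by apply/and4P; split.
case/and4P: ip => _ _ _ iw; have [|p [ip lp sp]] := IH w iw h.
  by move: xn; rewrite inE negb_or => /andP[].
by exists p; split=> // y /sp yq; rewrite inE yq orbT.
Qed.

(** Induction from the end: if [x] reappears on the shortened tail, restart there; otherwise jump to
    its last neighbour. *)
Lemma path_induced_path x p : path e x p ->
  exists q, [/\ induced_path x q, last x q = last x p & {subset q <= p}].
Proof.
elim: p x => [|z p IH] x /=; first by exists [::].
case/andP=> exz /IH[q [iq lq sq]].
have sub : {subset z :: q <= z :: p}.
  by move=> y; rewrite !inE => /orP[->//|/sq ->]; rewrite orbT.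
have [xq|xn] := boolP (x \in z :: q).
  have [r [ir lr sr]] := induced_path_suffix iq xq.
  by exists r; split=> //; [rewrite lr lq | move=> y /sr /sub].
have [|r [ir lr sr]] := induced_path_cons iq _ xn; first by rewrite /= exz.
by exists r; split=> //; [rewrite lr lq | move=> y /sr /sub].
Qed.

Hypothesis esym : symmetric e.
Hypothesis eirr : irreflexive e.

(** Whichever of [u], [v] comes first sees only its immediate successor among later vertices. Hence
    no chord of the cycle built below joins two path vertices. *)
Lemma induced_path_consecutive x p u v :
    induced_path x p -> u \in x :: p -> v \in x :: p -> e u v ->
  exists p1 p2, x :: p = p1 ++ [:: u, v & p2] \/ x :: p = p1 ++ [:: v, u & p2].
Proof.
elim: p x => [|z q IH] x.
  by rewrite !inE => _ /eqP -> /eqP ->; rewrite eirr.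
rewrite [induced_path _ _]/= => /and4P[exz nq xn iq].
have first w : w \in z :: q -> e x w -> w = z.
  rewrite inE => /orP[/eqP //|wq] exw.
  by case/hasP: nq; exists w.
rewrite (in_cons x (z :: q)) => /orP[/eqP -> |uq];
  rewrite (in_cons x (z :: q)) => /orP[/eqP -> |vq] euv.
- by rewrite eirr in euv.
- by exists [::], q; left; rewrite (first v).
- by exists [::], q; right; rewrite (first u) // esym.
- have [p1 [p2 [e1|e1]]] := IH z iq uq vq euv;
  exists (x :: p1), p2; rewrite e1; by [left|right].
Qed.

Lemma next_cat_consecutive (p1 p2 : seq T) u v :
  uniq (p1 ++ [:: u, v & p2]) -> next (p1 ++ [:: u, v & p2]) u = v.
Proof.
move=> us; rewrite -(next_rot (size p1) us) rot_size_cat /=.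
by rewrite eqxx.
Qed.

End InducedPath.

(** * Clique separators in chordal graphs *)

Section Chordal.
Set Implicit Arguments.
Unset Strict Implicit.
Unset Printing Implicit Defensive.
Variables (n : nat) (Rel : rel 'I_n).
Hypothesis tolR : tolerance Rel.
Hypothesis chR : chordal Rel.

Lemma gadj_sym : symmetric (gadj Rel).
Proof. by move=> i j; rewrite /gadj eq_sym tolR.2. Qed.

Lemma gadj_irr : irreflexive (gadj Rel).
Proof. by move=> i; rewrite /gadj eqxx. Qed.

(* Otherwise [b] and an induced path from [x] to [y] through [A] would form a
   chordless cycle. *)
Lemma chordal_common_neighbours (A : {set 'I_n}) (b x y : 'I_n) (p : seq 'I_n) :
  (forall z, z \in A -> z != b /\ ~~ gadj Rel z b) ->
  gadj Rel x b -> gadj Rel y b -> x != y ->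
  path (gadj Rel) x (rcons p y) -> {subset p <= A} -> Rel x y.
Proof.
move=> nb xb yb xy; set e := gadj Rel.
move=> /path_induced_path[q [iq lq sq]] pA; apply: contraT => nR.
rewrite last_rcons in lq.
have qA z : z \in x :: q -> [|| z == x, z == y | z \in A].
  rewrite inE => /orP[->//|/sq]; rewrite mem_rcons inE => /orP[->|/pA ->];
  by rewrite !orbT.
have neb z : gadj Rel z b -> z != b by case/andP.
have bq : b \notin x :: q.
  apply/negP => /qA /or3P[/eqP eb|/eqP eb|/nb[]]; last by rewrite eqxx.
  - by have := neb _ xb; rewrite -eb eqxx.
  - by have := neb _ yb; rewrite -eb eqxx.
have us : uniq (b :: x :: q) by rewrite cons_uniq bq (induced_path_uniq iq).
(* An empty [q] would give [x = y], and a single vertex would make [x] and [y] adjacent. *)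
have sz : (4 <= size (b :: x :: q))%N.
  case: q iq lq {sq qA bq us} => [_ /= e1|z [|w q]] //=.
    by rewrite e1 eqxx in xy.
  by move=> /andP[exz _] ezy; move: exz; rewrite ezy /e /gadj (negPf nR) andbF.
have cy : cycle e (b :: x :: q).
  rewrite /= rcons_path lq [e y b]yb (induced_path_path iq) andbT.
  by rewrite /e gadj_sym xb.
have [u [v [us1 vs1 euv nu pu]]] := chR sz us cy.
have bnb z : z \in x :: q -> gadj Rel z b -> z = x \/ z = y.
  by move=> /qA /or3P[/eqP|/eqP|/nb[_ /negPf->]]; auto.
have nextb : next (b :: x :: q) b = x by rewrite /= eqxx.
have nexty : next (b :: x :: q) y = b.
  have es : b :: x :: q = (b :: belast x q) ++ [:: y].
    by rewrite lastI /= lq cats1.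
  rewrite -(next_rot (size (b :: belast x q)) us) es rot_size_cat /=.
  by rewrite eqxx.
have prevn w z : next (b :: x :: q) w = z -> prev (b :: x :: q) z = w.
  by move=> <-; rewrite prev_next.
have prevb := prevn _ _ nexty; have prevx := prevn _ _ nextb.
have ebb : gadj Rel b b = false by rewrite gadj_irr.
(* A chord at [b] ends at [x] or [y], the cycle neighbours of [b]; a chord within the path joins
   consecutive vertices. Neither is a chord. *)
move: us1 vs1; rewrite !(in_cons b (x :: q)) => /orP[/eqP ub|uq]
  /orP[/eqP vb|vq].
- by rewrite ub vb ebb in euv.
- move: euv nu pu; rewrite ub gadj_sym nextb prevb => /(bnb _ vq)[]->;
  by rewrite eqxx.
- move: euv nu pu; rewrite vb => /(bnb _ uq)[]->; rewrite ?prevx ?nexty;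
  by rewrite eqxx.
- have [p1 [p2 [e1|e1]]] :=
    induced_path_consecutive gadj_sym gadj_irr iq uq vq euv.
    move: nu us; rewrite e1 -cat_cons => nu us.
    by rewrite (next_cat_consecutive us) eqxx in nu.
  have /prevn e2 : next (b :: x :: q) v = u.
    by move: us; rewrite e1 -cat_cons; exact: next_cat_consecutive.
  by rewrite e2 eqxx in pu.
Qed.

(* [A] is the connected component of [a] outside the neighbourhood of [b], and
   the separator consists of the neighbours of [A]. *)
Lemma chordal_clique_separator (U : {set 'I_n}) a b :
  a \in U -> b \in U -> a != b -> ~~ Rel a b ->
  exists V W : {set 'I_n}, [/\ V :|: W = U, V \proper U, W \proper U,
    clique Rel (V :&: W) &
    forall i j, i \in V -> i \notin W -> j \in W -> j \notin V -> ~~ Rel i j].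
Proof.
move=> aU bU ab nRab.
pose O := [set z in U | (z != b) && ~~ gadj Rel z b].
pose e := [rel u v | [&& gadj Rel u v, u \in O & v \in O]].
have esym : connect_sym e.
  by apply: sym_connect_sym => u v /=; rewrite gadj_sym [(v \in O) && _]andbC.
pose A := [set z | connect e a z].
have aO : a \in O by rewrite inE aU ab /gadj (negPf nRab) andbF.
have AO z : z \in A -> z \in O.
  rewrite inE => /connectP[p]; elim/last_ind: p => [_ -> //|p w _].
  by rewrite rcons_path last_rcons => /andP[_ /and3P[_ _ wO]] ->.
have step z w : z \in A -> w \in O -> gadj Rel z w -> w \in A.
  move=> zA wO g; rewrite inE; move: (zA); rewrite inE => /connect_trans; apply.
  by apply: connect1; rewrite /= g AO.
pose S := [set z in U | (z \notin A) && [exists w in A, gadj Rel w z]].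
(* A neighbour of [A] in [U] that is not adjacent to [b] lies in [O], hence in the component [A]
   itself. *)
have Sb z : z \in S -> gadj Rel z b.
  rewrite inE => /and3P[zU zA /exists_inP[w wA g]]; apply: contraNT zA => nzb.
  apply: (step w) => //; rewrite inE zU nzb andbT.
  apply: contraTneq g => ->.
  by have := AO _ wA; rewrite inE => /and3P[].
have AU z : z \in A -> z \in U by move/AO; rewrite inE => /and3P[].
have bA : b \notin A by apply/negP => /AO; rewrite inE eqxx andbF.
have aA : a \in A by rewrite inE connect0.
have bS : b \notin S by apply/negP=> /Sb; rewrite gadj_irr.
exists (A :|: S), (U :\: A); split.
- apply/setP => z; rewrite !in_setU in_setD.
  have [zA|zA] /= := boolP (z \in A); first by rewrite AU.
  by case: (boolP (z \in S)) => //; rewrite inE => /and3P[->].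
- apply/properP; split; last by exists b; rewrite // in_setU (negPf bA).
  apply/subsetP => z; rewrite in_setU => /orP[/AU //|].
  by rewrite inE => /and3P[].
- apply/properP; split; first exact: subsetDl.
  by exists a; rewrite // in_setD aA.
- move=> x y; rewrite !in_setI !in_setU !in_setD => /andP[xS /andP[xA xU]]
    /andP[yS /andP[yA yU]] xy.
  rewrite (negPf xA) /= in xS; rewrite (negPf yA) /= in yS.
  move: (xS) (yS); rewrite !inE => /and3P[_ _ /exists_inP[x' x'A gx]]
    /and3P[_ _ /exists_inP[y' y'A gy]].
  (* [x'] and [y'] are neighbours in [A] of the separator vertices [x] and [y]; a path between them
     inside [A] links [x] to [y]. *)
  have : connect e x' y'.
    by move: x'A y'A; rewrite !inE esym; exact: connect_trans.
  case/connectP => p ep ly.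
  apply: (@chordal_common_neighbours A b x y (x' :: p)); rewrite ?Sb //.
  + by move=> z /AO; rewrite inE => /and3P[].
  + rewrite rcons_cons /= gadj_sym gx rcons_path -ly gy andbT /=.
    by apply: sub_path ep => u v /= /and3P[].
  + elim: p x' x'A ep {gx ly} => [|z p IH] x' x'A /=.
      by move=> _ w; rewrite inE => /eqP ->.
    case/andP=> /and3P[g _ zO] ep w; rewrite inE => /orP[/eqP -> //|].
    by apply: IH => //; apply: step g.
(* Here [i] is in [A], so an edge to [j] outside [A] would put [j] in [S]. *)
- move=> i j; rewrite !in_setU !in_setD => iAS iW /andP[jA jU] jV.
  have iA : i \in A.
    have [//|iA] := boolP (i \in A).
    by move: iAS iW; rewrite (negPf iA) /= inE => /and3P[->].
  apply: contra jV => Rij; apply/orP; right; rewrite inE jU jA.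
  apply/exists_inP; exists i => //; rewrite /gadj Rij andbT.
  by apply: contraNneq jA => <-.
Qed.

Lemma max_clique_exists (D : {set 'I_n}) : clique Rel D ->
  exists2 D' : {set 'I_n}, max_clique Rel D' & D \subset D'.
Proof.
pose P (D : {set 'I_n}) := [forall i in D, forall j in D, (i != j) ==> Rel i j].
have PP D0 : reflect (clique Rel D0) (P D0).
  apply: (iffP 'forall_in_'forall_in_implyP) => h i.
    by move=> j ? ?; apply: h.
  by move=> ? j ? ?; apply: h.
move=> /PP /maxset_exists[D' /maxsetP[/PP cD' mD'] sD]; exists D' => //.
by split=> // D0 /PP; exact: mD'.
Qed.
End Chordal.

(** * Positive completion by induction on the vertex set *)

Section Completion.
Set Implicit Arguments.
Unset Strict Implicit.
Unset Printing Implicit Defensive.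
Variable C : numClosedFieldType.

Lemma mxsub_mulmx p q (f : 'I_q -> 'I_p) (A : 'M[C]_p) :
  mxsub f f A = rowsub f 1%:M *m A *m colsub f 1%:M.
Proof.
rewrite mulmx_colsub mulmx1 mul_rowsub_mx mul1mx.
by apply/matrixP=> i j; rewrite !mxE.
Qed.

Lemma psd_mxsub p q (f : 'I_q -> 'I_p) (A : 'M[C]_p) :
  psd A -> psd (mxsub f f A).
Proof.
move=> pA; have := @psd_congr _ _ _ A (rowsub f 1%:M) pA.
have -> : adjmx (rowsub f 1%:M : 'M[C]_(q, p)) = colsub f 1%:M.
  by apply/matrixP => i j; rewrite !mxE conjC_nat eq_sym.
by rewrite mxsub_mulmx.
Qed.

(** Compressing by a projection, rather than passing to a submatrix, keeps all matrices of one size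
    for gluing. *)
Definition coordproj p (S : {set 'I_p}) : 'M[C]_p :=
  diag_mx (\row_i (i \in S)%:R).

Lemma adjmx_coordproj p (S : {set 'I_p}) : adjmx (coordproj S) = coordproj S.
Proof.
apply/matrixP => i j; rewrite !mxE rmorphMn /= conjC_nat eq_sym.
by case: eqP => // ->.
Qed.

Lemma coordprojM p (S T : {set 'I_p}) :
  coordproj S *m coordproj T = coordproj (S :&: T).
Proof.
rewrite mulmx_diag; congr diag_mx; apply/rowP => i.
by rewrite !mxE in_setI -natrM mulnb.
Qed.

Lemma coordproj_compress p (S : {set 'I_p}) (A : 'M[C]_p) i j :
  (coordproj S *m A *m coordproj S) i j = A i j *+ ((i \in S) && (j \in S)).
Proof.
rewrite mul_mx_diag mul_diag_mx !mxE -mulnb.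
by rewrite mulr_natr mulr_natl mulrnA.
Qed.

(** Extension by zero: for J = [colsub f 1%:M], injectivity of [f] makes the projection equal to J
    J^*, and the submatrix is J^* A J. *)
Lemma psd_coordproj_mxsub p q (f : 'I_q -> 'I_p) (A : 'M[C]_p) :
  injective f -> psd (mxsub f f A) ->
  psd (coordproj [set f i | i : 'I_q] *m A *m coordproj [set f i | i : 'I_q]).
Proof.
move=> fI pA; set S := [set f i | i : 'I_q].
have E : coordproj S = colsub f 1%:M *m rowsub f 1%:M.
  apply/matrixP => i j; rewrite !mxE.
  have [/imsetP[k _ ->]|iS] := boolP (i \in S).
    rewrite (bigD1 k) //= !mxE eqxx mul1r big1 ?addr0 => [|l lk]; last first.
      by rewrite !mxE (inj_eq fI) eq_sym (negPf lk) mul0r.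
    by [].
  rewrite big1 ?mul0rn // => k _; rewrite !mxE.
  by case: eqP => [ik|]; rewrite ?mul0r //; rewrite ik imset_f in iS.
have := @psd_congr _ _ _ _ (colsub f 1%:M) pA.
have -> : adjmx (colsub f 1%:M : 'M[C]_(p, q)) = rowsub f 1%:M.
  by apply/matrixP => i j; rewrite !mxE conjC_nat eq_sym.
by rewrite mxsub_mulmx E !mulmxA.
Qed.

Lemma psd_glue_entries p (S T : {set 'I_p}) (F1 F2 : 'M[C]_p) :
  psd F1 -> psd F2 ->
  (forall i j, i \in S :&: T -> j \in S :&: T -> F1 i j = F2 i j) ->
  exists F, [/\ psd F, forall i j, i \in S -> j \in S -> F i j = F1 i j
    & forall i j, i \in T -> j \in T -> F i j = F2 i j].
Proof.
move=> p1 p2 e12.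
(* Only the compressions to [S] and [T] matter; agreement on the intersection makes the one to [T]
   equal that of [F2]. *)
pose M : 'M[C]_p := \matrix_(i, j)
  if (i \in S) && (j \in S) then F1 i j else F2 i j.
have M1 : coordproj S *m M *m coordproj S = coordproj S *m F1 *m coordproj S.
  by apply/matrixP => i j; rewrite !coordproj_compress mxE; case: ifP.
have M2 : coordproj T *m M *m coordproj T = coordproj T *m F2 *m coordproj T.
  apply/matrixP => i j; rewrite !coordproj_compress mxE.
  have [/andP[iT jT]|//] := boolP ((i \in T) && _).
  by case: ifP => // /andP[iS jS]; rewrite e12 // in_setI ?iS ?jS.
have pr R (G : 'M[C]_p) : psd G -> psd (coordproj R *m G *m coordproj R).
  by move=> pG; rewrite -{2}[coordproj R]adjmx_coordproj; exact: psd_congr.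
have [||||||| F [pF FS FT]] := @psd_glue _ _ M (coordproj S) (coordproj T).
- exact: adjmx_coordproj.
- exact: adjmx_coordproj.
- by rewrite coordprojM setIid.
- by rewrite coordprojM setIid.
- by rewrite !coordprojM setIC.
- by rewrite M1; exact: pr.
- by rewrite M2; exact: pr.
rewrite M1 in FS; rewrite M2 in FT; exists F; split=> // i j iS jS.
  by move/matrixP/(_ i j): FS; rewrite !coordproj_compress iS jS.
by move/matrixP/(_ i j): FT; rewrite !coordproj_compress iS jS.
Qed.

Variables (n : nat) (Rel : rel 'I_n).
Hypothesis tolR : tolerance Rel.
Hypothesis chR : chordal Rel.

(** The labelling [g] may put several indices over one vertex, so block entries are treated as
    scalar ones. *)
Lemma chordal_completion p (g : 'I_p -> 'I_n) (A : 'M[C]_p) (U : {set 'I_n}) :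
  (forall D, max_clique Rel D ->
     psd (coordproj (g @^-1: D) *m A *m coordproj (g @^-1: D))) ->
  exists2 F, psd F & forall i j, g i \in U -> g j \in U -> Rel (g i) (g j) ->
    F i j = A i j.
Proof.
move=> pA; have [k] := ubnP #|U|; elim: k U => // k IH U; rewrite ltnS => Uk.
have [/existsP[a /existsP[b /and4P[aU bU ab nab]]]|ncl] :=
  boolP [exists a, exists b, [&& a \in U, b \in U, a != b & ~~ Rel a b]].
  have [V [W [VW pV pW cl sep]]] :=
    chordal_clique_separator tolR chR aU bU ab nab.
  have [|F1 p1 E1] := IH V; first by apply: leq_trans Uk; exact: proper_card.
  have [|F2 p2 E2] := IH W; first by apply: leq_trans Uk; exact: proper_card.
  have [||i j|F [pF FV FW]] :=
    @psd_glue_entries _ (g @^-1: V) (g @^-1: W) F1 F2.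
  - exact: p1.
  - exact: p2.
  (* The separator is a clique, so on it both completions equal [A]. *)
  - rewrite !inE => iVW jVW.
    have Rij : Rel (g i) (g j).
      by have [->|nij] := eqVneq (g i) (g j);
        [exact: tolR.1 | apply: cl; rewrite ?in_setI].
    by move: iVW jVW => /andP[? ?] /andP[? ?]; rewrite E1 ?E2.
  exists F => // i j; rewrite -VW !in_setU => iU jU Rij.
  have [/andP[iV jV]|nV] := boolP ((g i \in V) && (g j \in V)).
    by rewrite FV ?E1 // inE.
  have [/andP[iW jW]|nW] := boolP ((g i \in W) && (g j \in W)).
    by rewrite FW ?E2 // inE.
  (* Otherwise the two vertices lie on opposite sides of the separator, which [Rij] excludes. *)
  have := sep (g i) (g j); have := sep (g j) (g i).
  rewrite (tolR.2 (g j)) Rij; move: iU jU nV nW.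
  by do 4![case: (_ \in _)] => //= *; do ?[exfalso; auto].
have [|D mD /subsetP UD] := @max_clique_exists _ Rel U.
  move=> i j iU jU ij; apply: contraNT ncl => nij.
  by apply/existsP; exists i; apply/existsP; exists j; apply/and4P.
exists (coordproj (g @^-1: D) *m A *m coordproj (g @^-1: D)); first exact: pA.
by move=> i j iU jU _; rewrite coordproj_compress !inE !UD.
Qed.

End Completion.

(** * Block indices, the two implications and injectivity *)

Section Blocks.
Set Implicit Arguments.
Unset Strict Implicit.
Unset Printing Implicit Defensive.
Variable C : numClosedFieldType.

Definition block_row m d (s : 'I_(\sum_(k < m) d)) : 'I_m := tagnat.sig1 s.
Definition block_vertex m d (s : 'I_(\sum_(k < m) d)) : 'I_d := tagnat.sig2 s.
Definition block_index m d (k : 'I_m) (i : 'I_d) : 'I_(\sum_(k < m) d) :=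
  @tagnat.Rank m (fun=> d) k i.

Lemma block_indexK1 m d k i : block_row (@block_index m d k i) = k.
Proof. exact: tagnat.Rank1K. Qed.

Lemma block_indexK2 m d k i : block_vertex (@block_index m d k i) = i.
Proof. by rewrite /block_vertex /block_index tagnat.Rank2K; apply: val_inj. Qed.

Lemma block_indexK m d (s : 'I_(\sum_(k < m) d)) :
  block_index (block_row s) (block_vertex s) = s.
Proof. exact: tagnat.sig2K. Qed.

Lemma blockmxE m d (M : 'M['M[C]_d]_m) s t : blockmx M s t =
  M (block_row s) (block_row t) (block_vertex s) (block_vertex t).
Proof. by rewrite mxE. Qed.

Definition restr_index m d (D : {set 'I_d}) (s : 'I_(\sum_(k < m) #|D|)) :
    'I_(\sum_(k < m) d) :=
  block_index (block_row s) (enum_val (block_vertex s)).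

Lemma restr_index_inj m d (D : {set 'I_d}) : injective (@restr_index m d D).
Proof.
move=> s t e; rewrite -[s]block_indexK -[t]block_indexK.
have := congr1 (@block_row _ _) e; rewrite !block_indexK1 => ->.
have := congr1 (@block_vertex _ _) e; rewrite !block_indexK2.
by move=> /enum_val_inj ->.
Qed.

Lemma restr_index_image m d (D : {set 'I_d}) :
  [set restr_index s | s : 'I_(\sum_(k < m) #|D|)] =
  (@block_vertex m d) @^-1: D.
Proof.
apply/setP => s; rewrite inE; apply/imsetP/idP => [[t _ ->]|sD].
  by rewrite block_indexK2 enum_valP.
exists (block_index (block_row s) (enum_rank_in sD (block_vertex s))) => //.
by rewrite /restr_index block_indexK1 block_indexK2 enum_rankK_in ?block_indexK.
Qed.

Lemma blockmx_restr m d (D : {set 'I_d}) (M : 'M['M[C]_d]_m) :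
  blockmx (\matrix_(k, l) restr D (M k l)) =
  mxsub (@restr_index m d D) (@restr_index m d D) (blockmx M).
Proof.
apply/matrixP => s t; rewrite [RHS]mxE !blockmxE !block_indexK1 !block_indexK2.
by rewrite !mxE.
Qed.

Variables (n : nat) (Rel : rel 'I_n).
Hypothesis tolR : tolerance Rel.

Lemma clique_rel (D : {set 'I_n}) i j :
  clique Rel D -> i \in D -> j \in D -> Rel i j.
Proof.
move=> cD iD jD; have [->|ij] := eqVneq i j; first exact: tolR.1.
exact: cD.
Qed.

(** [N] vanishes on pairs within a clique, so the restriction of [M] is a principal submatrix of the
    positive [blockmx (M + N)]. *)
Lemma dual_pos_phi_pos m (M : 'M['M[C]_n]_m) : dual_pos Rel M -> phi_pos Rel M.
Proof.
move=> [N [NR pMN]] D [cD _].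
have -> : (\matrix_(k, l) restr D (M k l)) =
          \matrix_(k, l) restr D ((M + N) k l).
  apply/matrixP => k l; rewrite !mxE.
  apply/matrixP => i j; rewrite !mxE NR ?addr0 //.
  by apply: (clique_rel cD); exact: enum_valP.
by rewrite blockmx_restr; exact: psd_mxsub.
Qed.

Lemma phi_pos_dual_pos m (M : 'M['M[C]_n]_m) :
  chordal Rel -> phi_pos Rel M -> dual_pos Rel M.
Proof.
move=> chR pM.
have [|F pF FM] := @chordal_completion C n Rel tolR chR _
  (@block_vertex m n) (blockmx M) setT.
  move=> D mD; rewrite -restr_index_image; apply: psd_coordproj_mxsub.
    exact: restr_index_inj.
  by rewrite -blockmx_restr; exact: pM.
(* The completion minus [M]; it vanishes on related pairs because [F] agrees with [M] there. *)
pose N : 'M['M[C]_n]_m := \matrix_(k, l) \matrix_(i, j)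
  (F (block_index k i) (block_index l j) - M k l i j).
exists N; split.
  move=> k l i j Rij; rewrite !mxE FM ?inE ?block_indexK2 // blockmxE.
  by rewrite !block_indexK1 !block_indexK2 subrr.
suff e : blockmx (M + N) = F by rewrite e.
by apply/matrixP => s t; rewrite blockmxE !mxE !block_indexK addrC subrK.
Qed.

Lemma restr_max_cliques_inj (x y : 'M[C]_n) :
  inE_R 0 Rel x -> inE_R 0 Rel y ->
  (forall D, max_clique Rel D -> restr D x = restr D y) -> x = y.
Proof.
move=> xE yE xy; apply/matrixP => i j.
have [Rij|nR] := boolP (Rel i j); last by rewrite xE ?yE.
(* A related pair is a clique, so some maximal clique sees the entry at [i], [j]. *)
have [|D mD /subsetP sD] := @max_clique_exists _ Rel [set i; j].
  move=> a b; rewrite !inE => /orP[]/eqP -> /orP[]/eqP -> //; rewrite ?eqxx //.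
  by rewrite tolR.2.
have iD : i \in D by rewrite sD // !inE eqxx.
have jD : j \in D by rewrite sD // !inE eqxx orbT.
have /matrixP/(_ (enum_rank_in iD i) (enum_rank_in iD j)) := xy D mD.
by rewrite !mxE !enum_rankK_in.
Qed.
End Blocks.

Theorem mainTheorem2 (R : realType) (n : nat) (Rel : rel 'I_n) :
  tolerance Rel -> chordal Rel ->
  forall m : nat,
    (* Phi_m is injective on M_m(E(R)) *)
    (forall M N : 'M['M[R[i]]_n]_m,
        (forall k l, inE_R 0 Rel (M k l)) -> (forall k l, inE_R 0 Rel (N k l)) ->
        (forall D : {set 'I_n}, max_clique Rel D ->
           forall k l, restr D (M k l) = restr D (N k l)) ->
        M = N) /\
    (* Phi_m is an order embedding *)
    (forall M : 'M['M[R[i]]_n]_m,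
        (forall k l, inE_R 0 Rel (M k l)) ->
        (dual_pos Rel M <-> phi_pos Rel M)).
Proof.
move=> tolR chR m; split=> [M N ME NE MN|M _].
  apply/matrixP => k l; apply: (restr_max_cliques_inj tolR (ME k l) (NE k l)).
  by move=> D mD; exact: MN.
by split; [exact: dual_pos_phi_pos | exact: phi_pos_dual_pos].
Qed.
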